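(* Let $n$ be an even positive integer, and let $E$ and $O$ be the sets of even and odd elements of $\mathbb{Z}_n$, respectively. Let $\mathcal{A}\subseteq\mathbb{Z}_{n}$ and write $\mathcal{A}_{e}=E\cap\mathcal{A}$ and $\mathcal{A}_{o}=O\cap\mathcal{A}$. If $|\mathcal{A}_e|\geq \frac{n}{4}+3$ and $|\mathcal{A}_o|\geq 2$, then $4^{\wedge}\mathcal{A}=\mathbb{Z}_{n}$.
   Context: $\mathbb{Z}_n$ denotes the additive cyclic group of integers modulo $n$. For even $n$, an element of $\mathbb{Z}_n$ is called even (resp. odd) if it is the class of an even (resp. odd) integer; this is well defined since $n$ is even. For a positive integer $h\ge 2$ and a subset $\mathcal{A}$ of $\mathbb{Z}_n$, $h^{\wedge}\mathcal{A}$ denotes the set of elements of $\mathbb{Z}_n$ that can be written as a sum of $h$ pairwise distinct elements of $\mathcal{A}$. *)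

(* Defs.v *)
From HB Require Import structures.
From mathcomp Require Import all_boot all_order all_algebra.

Set Implicit Arguments.
Unset Strict Implicit.
Unset Printing Implicit Defensive.

Import Order.TTheory GRing.Theory Num.Theory.
Local Open Scope ring_scope.

(* Parity is read on the representative in {0, ..., n-1}; Zp_evensP and
   Zp_oddsP below show that, for even n > 0, this is being the class of an
   even (resp. odd) integer. *)
Definition Zp_evens (n : nat) : {set 'Z_n} := [set x : 'Z_n | ~~ odd x].
Definition Zp_odds (n : nat) : {set 'Z_n} := [set x : 'Z_n | odd x].

Definition restricted_sumset (V : finZmodType) (h : nat) (A : {set V}) :
    {set V} :=
  [set \sum_(x <- t) x | t : h.-tuple V & uniq t && all (mem A) t].

Lemma odd_intr_Zp (n : nat) (k : int) :
  (0 < n)%N -> ~~ odd n -> odd (k%:~R : 'Z_n) = odd `|k|%N.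
Proof.
case: n => [|[|n]] // _ n_even.
have odd_natr (m : nat) : odd (m%:R : 'Z_n.+2) = odd m.
  by rewrite val_Zp_nat // odd_mod // (negbTE n_even).
case: k => m; first exact: odd_natr.
rewrite NegzE mulrNz abszN absz_nat /=.
rewrite -[(m.+1%:Z)%:~R]/(m.+1%:R : 'Z_n.+2) odd_mod ?(negbTE n_even) //.
by rewrite oddB ?(ltnW (ltn_ord _)) // odd_natr (negbTE n_even).
Qed.

Lemma intr_valZp (n : nat) (x : 'Z_n) : x = (x : nat)%:Z%:~R.
Proof. by rewrite -[RHS]/((x : nat)%:R : 'Z_n) natr_Zp. Qed.

Lemma Zp_evensP (n : nat) (x : 'Z_n) : (0 < n)%N -> ~~ odd n ->
  reflect (exists k : int, ~~ odd `|k|%N /\ x = k%:~R) (x \in Zp_evens n).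
Proof.
move=> n_gt0 n_even; rewrite inE; apply: (iffP idP) => [ev_x | [k [ev_k ->]]].
  by exists (x : nat)%:Z; split; [rewrite absz_nat | exact: intr_valZp].
by rewrite odd_intr_Zp.
Qed.

Lemma Zp_oddsP (n : nat) (x : 'Z_n) : (0 < n)%N -> ~~ odd n ->
  reflect (exists k : int, odd `|k|%N /\ x = k%:~R) (x \in Zp_odds n).
Proof.
move=> n_gt0 n_even; rewrite inE; apply: (iffP idP) => [od_x | [k [od_k ->]]].
  by exists (x : nat)%:Z; split; [rewrite absz_nat | exact: intr_valZp].
by rewrite odd_intr_Zp.
Qed.

(* Main.v *)
Require Import Defs.
From HB Require Import structures.
From mathcomp Require Import all_boot all_order all_algebra.
From mathcomp Require Import zify.

(** The even classes form a subgroup [E] of order n/2, so the hypothesis says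
    that B = E :&: A exceeds half of [E] by at least three elements.  Two such
    large subsets of [E] must meet: for every [g] in [E], the sets [B] and
    g - B share at least 2|B| - |E| >= 6 elements, that is, there are at least
    six ordered ways to write [g] as a sum of two elements of [B].  Only
    representations of the form g = x + x are to be avoided, and since doubling
    is at most two-to-one on a cyclic group there are at most two of those
    ([card_halves_Zp]).  Hence every even class is a sum of two distinct
    elements of [B] ([sum_of_two_distinct]); as 6 - 2 > 2, this remains true
    after one element of [B] has been discarded, which makes every even class a
    sum of three distinct elements of [B] as well.

    An even class is then the sum of two fixed odd elements of [A] and of two
    elements of [B], and an odd class is the sum of one odd element of [A] and
    of three elements of [B].  Parity keeps the odd summands distinct from the
    even ones. *)

Set Implicit Arguments.
Unset Strict Implicit.
Unset Printing Implicit Defensive.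

Import Order.TTheory GRing.Theory Num.Theory.
Local Open Scope ring_scope.

(** The pigeonhole step: [B] and its reflection g - B both lie in [E], so their
    intersection has at least 2|B| - |E| elements, too many for all of them to
    be halves of [g]. *)
Lemma sum_of_two_distinct (V : finZmodType) (E B : {set V}) (g : V) :
    B \subset E -> {in E, forall x, g - x \in E} ->
    (#|[set x : V | (x + x == g)%R]| + #|E| < #|B|.*2)%N ->
  exists x y, [/\ x \in B, y \in B, x != y & x + y = g].
Proof.
move=> sBE Eg cardB.
pose B' := [set g - x | x in B].
have card_B' : #|B'| = #|B|.
  by apply: card_imset => x y /addrI /oppr_inj.
have sUE : B :|: B' \subset E.
  rewrite subUset sBE; apply/subsetP=> _ /imsetP[x Bx ->].
  exact/Eg/(subsetP sBE).
have cardI : (#|[set x : V | (x + x == g)%R]| < #|B :&: B'|)%N.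
  by have := subset_leq_card sUE; have := cardsUI B B'; rewrite card_B'; lia.
have /subsetPn[x] : ~~ (B :&: B' \subset [set x : V | x + x == g]).
  by apply: contraL cardI => /subset_leq_card; rewrite leqNgt.
rewrite !inE => /andP[Bx /imsetP[y By xE]] xx_neq_g.
exists x, y; split=> //; last by rewrite xE subrK.
by apply: contra_neq xx_neq_g => xy; rewrite {2}xy xE subrK.
Qed.

Lemma odd_addZp (n : nat) (x y : 'Z_n) :
  (0 < n)%N -> ~~ odd n -> odd (x + y)%R = odd x (+) odd y.
Proof.
by case: n x y => [|[|n]] // x y _ n_even; rewrite /= odd_mod ?oddD //;
  apply: negbTE.
Qed.

Lemma odd_oppZp (n : nat) (x : 'Z_n) :
  (0 < n)%N -> ~~ odd n -> odd (- x)%R = odd x.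
Proof.
move=> n_gt0 n_even; have := odd_addZp (- x) x n_gt0 n_even.
by rewrite addNr; case: (odd x); case: (odd (- x)%R).
Qed.

(** Translation by 1 injects the even classes into the odd ones. *)
Lemma card_Zp_evens_le (n : nat) :
  (0 < n)%N -> ~~ odd n -> (#|Zp_evens n|.*2 <= n)%N.
Proof.
move=> n_gt0 n_even.
have n_gt1 : (1 < n)%N by case: n n_gt0 n_even => [|[|n]].
have odd1 : odd (1%R : 'Z_n) by [].
have sE : [set x + 1 | x in Zp_evens n] \subset ~: Zp_evens n.
  apply/subsetP=> _ /imsetP[x x_even ->]; rewrite !inE in x_even *.
  by rewrite negbK odd_addZp // odd1 addbT.
have := subset_leq_card sE; rewrite card_imset; last exact: addIr.
have := cardsC (Zp_evens n).
have -> : #|'Z_n| = n by rewrite card_ord Zp_cast.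
by move=> cardC ?; rewrite -addnn -[leqRHS]cardC leq_add2l.
Qed.

(** Two halves of the same class differ by a class killed by 2; the double of
    its representative is then 0 or the modulus itself. *)
Lemma card_halves_Zp (n : nat) (g : 'Z_n) :
  (#|[set x : 'Z_n | (x + x == g)%R]| <= 2)%N.
Proof.
have [-> | [x0]] := set_0Vmem [set x : 'Z_n | x + x == g].
  by rewrite cards0.
rewrite inE => /eqP x0E.
pose N := (Zp_trunc n).+2.
suff sH : [set x : 'Z_n | x + x == g] \subset [set x0; x0 + inZp N./2].
  by apply: leq_trans (subset_leq_card sH) _; rewrite cards2; case: eqP.
apply/subsetP=> x; rewrite !inE => /eqP xE.
have dd0 : (x - x0) + (x - x0) = 0.
  by rewrite addrACA xE -opprD x0E subrr.
rewrite -subr_eq0 [x0 + _]addrC -subr_eq.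
move: (x - x0) dd0 => d /(congr1 val) /= dd0.
have d_lt : (d < N)%N := ltn_ord d.
have [d0 | d_gt0] := posnP d; first by apply/orP; left; apply/eqP/val_inj.
apply/orP; right; apply/eqP/val_inj => /=; rewrite -/N.
have : (d + d = N)%N.
  have /dvdnP[k kE] : (N %| d + d)%N by rewrite /dvdn; apply/eqP.
  have : (k < 2)%N by rewrite -(ltn_pmul2r (ltn0Sn _ : 0 < N)%N) -kE; lia.
  by case: k kE => [|[|k]] //; lia.
move=> /(congr1 half); rewrite addnn doubleK => dE.
by have := d_lt; rewrite dE => /modn_small ->.
Qed.

Lemma restricted_sumset_seq (V : finZmodType) (A : {set V}) (s : seq V) :
  uniq s -> all (mem A) s -> \sum_(x <- s) x \in restricted_sumset (size s) A.
Proof.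
by move=> s_uniq sA; apply/imsetP; exists (in_tuple s); rewrite // inE s_uniq.
Qed.

Theorem theorem1p2 (n : nat) (n_gt0 : (0 < n)%N) (n_even : ~~ odd n)
    (A : {set 'Z_n})
    (hAe : n%:R / 4%:R + 3%:R <= #|Zp_evens n :&: A|%:R :> rat)
    (hAo : (2 <= #|Zp_odds n :&: A|)%N) :
  restricted_sumset 4 A = [set: 'Z_n].
Proof.
set E := Zp_evens n in hAe; set B := E :&: A in hAe.
have cardB : (#|E| + 6 <= #|B|.*2)%N.
  have : (n + 12 <= #|B| * 4)%N.
    rewrite -(ler_nat rat) natrD natrM -ler_pdivrMr // mulrDl.
    by apply: le_trans hAe; rewrite lerD2l.
  have : (#|E|.*2 <= n)%N by exact: card_Zp_evens_le.
  lia.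
have sBE : B \subset E by apply: subsetIl.
have BP (x : 'Z_n) : x \in B -> ~~ odd x /\ x \in A by rewrite !inE => /andP[].
have two_in (C : {set 'Z_n}) (g : 'Z_n) :
    C \subset E -> ~~ odd g -> (#|E| + 2 < #|C|.*2)%N ->
  exists x y, [/\ x \in C, y \in C, x != y & x + y = g].
  move=> sCE g_even cardC; apply: sum_of_two_distinct sCE _ _.
    move=> x; rewrite !inE => x_even.
    by rewrite odd_addZp // odd_oppZp // (negbTE g_even).
  apply: leq_ltn_trans cardC; rewrite addnC leq_add2l; exact: card_halves_Zp.
have /card_gt1P[o1 [o2 []]] := hAo.
rewrite !inE => /andP[o1_odd Ao1] /andP[o2_odd Ao2] o1_neq_o2.
have neq_parity (x y : 'Z_n) : odd x -> ~~ odd y -> x != y.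
  by move=> x_odd; apply: contraNneq => <-.
apply/setP=> z; rewrite in_setT.
have [z_odd | z_even] := boolP (odd z).
- have [b Bb] : exists b, b \in B by apply/card_gt0P; lia.
  have [b_even Ab] := BP b Bb.
  have g_even : ~~ odd (z - o1 - b)%R.
    rewrite odd_addZp // odd_oppZp // odd_addZp // odd_oppZp //.
    by rewrite z_odd o1_odd.
  have [|//||x [y [/setD1P[x_neq_b Bx] /setD1P[y_neq_b By] xy xyE]]] :=
    two_in (B :\ b) (z - o1 - b).
  + exact: subset_trans (subD1set _ _) sBE.
  + by have := cardsD1 b B; rewrite Bb; lia.
  have [x_even Ax] := BP x Bx; have [y_even Ay] := BP y By.
  have -> : z = \sum_(u <- [:: o1; b; x; y]) u.
    by rewrite !big_cons big_nil addr0 xyE (addrC b) subrK addrC subrK.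
  apply: restricted_sumset_seq; last by rewrite /= Ao1 Ab Ax Ay.
  rewrite /= !inE !negb_or !(neq_parity o1) //= xy.
  by rewrite eq_sym x_neq_b eq_sym y_neq_b.
have g_even : ~~ odd (z - o1 - o2)%R.
  rewrite odd_addZp // odd_oppZp // odd_addZp // odd_oppZp //.
  by rewrite (negbTE z_even) o1_odd o2_odd.
have [|x [y [Bx By xy xyE]]] :=
  two_in B (z - o1 - o2) sBE g_even; first by lia.
have [x_even Ax] := BP x Bx; have [y_even Ay] := BP y By.
have -> : z = \sum_(u <- [:: o1; o2; x; y]) u.
  by rewrite !big_cons big_nil addr0 xyE (addrC o2) subrK addrC subrK.
apply: restricted_sumset_seq; last by rewrite /= Ao1 Ao2 Ax Ay.
by rewrite /= !inE !negb_or o1_neq_o2 !(neq_parity o1, neq_parity o2) //= xy.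
Qed.
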